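(* Let $\mathcal X$ and $\hat{\mathcal X}$ be finite alphabets with $J=|\mathcal X|$, let $D$ be the allowed per-letter distortion, and let $d:\mathcal X^n\times\hat{\mathcal X}^n\to\mathbb R^+$ be an arbitrary distortion function. Then, for every $\epsilon>0$, there exists a sequence of $d$-semifaithful (at distortion level $D$), variable-length, prefix-free block codes of block length $n$, such that for every $x\in\mathcal X^n$, the code length for $x$ is upper bounded by $$L(x)\ \le\ -\log\big(U[\mathcal S(x,D)]\big)+(2+\epsilon)\log n+c+\delta_n,$$ where $c>0$ is a constant and $\delta_n=O\big(nJ^ne^{-n^{1+\epsilon}}\big)$.
   Context: All logarithms $\log$ are to base 2. $\mathcal X$ (source alphabet) and $\hat{\mathcal X}$ (reproduction alphabet) are finite, with cardinalities $J=|\mathcal X|$ and $K=|\hat{\mathcal X}|$. For a given positive integer $n$, a distortion function is a function $d$ from $\mathcal X^n\times\hat{\mathcal X}^n$ into $\mathbb R^+$ (the nonnegative reals); here it may be completely arbitrary. Codes. A (variable-length) rate-distortion block code of length $n$ consists of an encoder $\phi_n:\mathcal X^n\to\mathcal B_n$, where $\mathcal B_n\subset\{0,1\}^*$ is a set of variable-length binary strings, and a decoder $\psi_n:\mathcal B_n\to\mathcal C_n\subseteq\hat{\mathcal X}^n$, where $\mathcal C_n$ is the reproduction codebook. It is prefix-free if no string in $\mathcal B_n$ is a proper prefix of another string in $\mathcal B_n$. The code is $d$-semifaithful (at level $D$) if $d(x,\psi_n(\phi_n(x)))\le nD$ for every $x\in\mathcal X^n$. The code length $L(x)$ is the number of bits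 of $\phi_n(x)$. LZ78 code length. The incremental parsing of $\hat x\in\hat{\mathcal X}^n$ sequentially parses $\hat x$ into phrases such that each new phrase is the shortest string not encountered before as a parsed phrase, with the possible exception of the last phrase, which may be incomplete (example: abbabaabbaaabaa is parsed as a,b,ba,baa,bb,aa,ab,aa). Let $c(\hat x)$ be the number of phrases. $LZ(\hat x)$ denotes the length in bits of the LZ78 (1978 version of the Lempel-Ziv algorithm) binary code of $\hat x$: the $j$-th phrase is encoded by the pair (index in $\{0,\dots,j-1\}$ of the earlier phrase, $0$ being the empty phrase, equal to the phrase with its last symbol removed; last symbol) using $\lceil\log(jK)\rceil$ bits, so that $LZ(\hat x)=\sum_{j=1}^{c(\hat x)}\lceil\log(jK)\rceil$. Universal distribution and spheres. $U(\hat x)=2^{-LZ(\hat x)}\big/\sum_{\hat x'\in\hat{\mathcal X}^n}2^{-LZ(\hat x')}$ for $\hat x\in\hat{\mathcal X}^n$; $\mathcal S(x,D)=\{\hat x\in\hat{\mathcal X}^n: d(x,\hat x)\le nD\}$; $U[\mathcal S(x,D)]=\sum_{\hat x\in\mathcal S(x,D)}U(\hat x)$.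
   Formalization: The formal theorem assumes that for every n ≥ 1 and every x the sphere S(x,D) is nonempty; otherwise (e.g. d ≡ 1, D = 0) no d-semifaithful code exists and -log U[S(x,D)] is undefined. *)

(* Defs.v *)
From HB Require Import structures.
From mathcomp Require Import all_boot all_order all_algebra.
From mathcomp Require Import all_classical all_reals all_analysis.

Set Implicit Arguments.
Unset Strict Implicit.
Unset Printing Implicit Defensive.

Import Order.TTheory GRing.Theory Num.Theory.
Import numFieldNormedType.Exports.

Local Open Scope ring_scope.

Definition log2 (R : realType) (x : R) : R := ln x / ln 2.

(* [dict] holds the phrases parsed so far and [cur] the pending prefix of the
   current phrase: either empty or a member of [dict]. A nonempty [cur] left at
   the end of the input is the (incomplete) last phrase. *)
Fixpoint lz78_parse_from (T : eqType) (dict : seq (seq T)) (cur s : seq T) :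
    seq (seq T) :=
  if s is a :: s' then
    let w := rcons cur a in
    if w \in dict then lz78_parse_from dict w s'
    else w :: lz78_parse_from (w :: dict) [::] s'
  else if nilp cur then [::] else [:: cur].

Definition lz78_parse (T : eqType) (s : seq T) : seq (seq T) :=
  lz78_parse_from [::] [::] s.

(* abbabaabbaaabaa is parsed as a,b,ba,baa,bb,aa,ab,aa *)
Example lz78_parse_example :
  let a := false in let b := true in
  lz78_parse [:: a; b; b; a; b; a; a; b; b; a; a; a; b; a; a] =
    [:: [:: a]; [:: b]; [:: b; a]; [:: b; a; a]; [:: b; b]; [:: a; a];
        [:: a; b]; [:: a; a]].
Proof. by []. Qed.

(* [up_log 2 m] is the ceiling of the base-2 logarithm of [m > 0]. *)
Definition LZ (T : finType) (s : seq T) : nat :=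
  (\sum_(1 <= j < (size (lz78_parse s)).+1) up_log 2 (j * #|T|))%N.

Definition univ_dist (R : realType) (T : finType) (n : nat)
    (y : n.-tuple T) : R :=
  2 ^- LZ y / \sum_(y' : n.-tuple T) 2 ^- LZ y'.

Definition sphere (R : realType) (X Y : finType) (n : nat)
    (d : n.-tuple X -> n.-tuple Y -> R) (D : R) (x : n.-tuple X) :
    {set n.-tuple Y} :=
  [set y | d x y <= n%:R * D]%SET.

Definition univ_mass (R : realType) (T : finType) (n : nat)
    (A : {set n.-tuple T}) : R :=
  \sum_(y in A) univ_dist R y.

(* A variable-length rate-distortion block code of length [n]; the decoder is
   defined only on the set [strings] of binary strings of the code. *)
Record rd_code (X Y : finType) (n : nat) := RDCode {
  strings : {pred seq bool};
  codebook : {set n.-tuple Y};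
  encode : n.-tuple X -> {b : seq bool | b \in strings};
  decode : {b : seq bool | b \in strings} -> {y : n.-tuple Y | y \in codebook}
}.

Section RDCodeProperties.
Variables (X Y : finType) (n : nat) (C : rd_code X Y n).

Definition reproduction (x : n.-tuple X) : n.-tuple Y :=
  sval (decode (encode C x)).

Definition code_length (x : n.-tuple X) : nat := size (sval (encode C x)).

Definition prefix_free : Prop :=
  forall b1 b2 : seq bool, b1 \in strings C -> b2 \in strings C ->
    ~ (prefix b1 b2 /\ b1 <> b2).

Definition semifaithful (R : realType) (d : n.-tuple X -> n.-tuple Y -> R)
    (D : R) : Prop :=
  forall x : n.-tuple X, d x (reproduction x) <= n%:R * D.

End RDCodeProperties.

(* Main.v *)
(** Fix the block length [n] and let [k] be the least level with
    [2^-k <= U[S(x, D)]]. By averaging over [U], some reproduction word lies in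
    at least a fraction [2^-k] of the spheres of level [k] that are not yet hit;
    choosing such words greedily [2^k m] times shrinks the number of missed
    spheres by the factor [(1 - 2^-k)^(2^k m) <= 2^-m], so that [m] of order
    [n #|X|] suffices to hit them all. The codeword of [x] is [k] followed by
    the index of a hitting word among those chosen for level [k], both in fixed
    length. As [-log U] is at most of order [n log n], writing [k] takes
    [log n + O(log log n)] bits, the index takes [k + log n + O(1)] bits, and
    [eps log n] absorbs the doubly logarithmic term. This greedy choice
    replaces random coding and gives [delta_n = 0]. *)
Require Import Defs.
From mathcomp Require Import all_boot all_order all_algebra.
From mathcomp Require Import all_classical all_reals all_analysis.
From mathcomp Require Import lra.
Import Order.TTheory GRing.Theory Num.Theory.
Import numFieldNormedType.Exports.
Local Open Scope classical_set_scope.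
Local Open Scope ring_scope.

(** * Estimates for the base-2 logarithm *)

Lemma log2_expn (R : realType) (k : nat) : log2 (2 ^+ k : R) = k%:R.
Proof.
have ln2_gt0 : 0 < ln (2 : R) by rewrite ln_gt0// ltr1n.
by rewrite /log2 lnXn// mulrnAl divff ?gt_eqF.
Qed.

Lemma log2_expnN (R : realType) (k : nat) : log2 (2 ^- k : R) = - k%:R.
Proof. by rewrite -(log2_expn R k) /log2 lnV ?posrE ?exprn_gt0// mulNr. Qed.

Lemma ler_log2 (R : realType) (x y : R) : 0 < x -> x <= y -> log2 x <= log2 y.
Proof.
move=> x_gt0 le_xy.
have ln2_gt0 : 0 < ln (2 : R) by rewrite ln_gt0// ltr1n.
by rewrite ler_pM2r ?invr_gt0// ler_ln// posrE// (lt_le_trans x_gt0).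
Qed.

Lemma up_log_le_log2 (R : realType) (m : nat) : (0 < m)%N ->
  (up_log 2 m)%:R <= log2 (m%:R : R) + 1.
Proof.
move=> m_gt0; have [m_le1|m_gt1] := leqP m 1.
  have -> : m = 1%N by apply/eqP; rewrite eqn_leq m_le1.
  by rewrite up_log1 /log2 ln1 mul0r add0r ler01.
have /ltnW := @up_log_gtn 2 m isT m_gt1.
rewrite -(ler_nat R) natrX => /(@ler_log2 R _ _ (exprn_gt0 _ (ltr0Sn R 1))).
rewrite log2_expn => le_m.
by rewrite -[up_log 2 m]prednK ?up_log_gt0// -natr1 lerD2r.
Qed.

(** Used with [a := eps] and [y] of order log n, to turn a doubly logarithmic cost into [eps] log n
    plus a constant. It is ln z <= z at z = [a * y * ln 2]. *)
Lemma log2_le_linear (R : realType) (a : R) : 0 < a ->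
  exists b : R, forall y : R, 0 < y -> log2 y <= a * y + b.
Proof.
move=> a_gt0.
have ln2_gt0 : 0 < ln (2 : R) by rewrite ln_gt0// ltr1n.
have al_gt0 : 0 < a * ln 2 by rewrite mulr_gt0.
exists (- log2 (a * ln 2)) => y y_gt0.
rewrite -lerBlDr opprK /log2 -mulrDl -lnM ?posrE//.
rewrite ler_pdivrMr// (mulrC y) mulrAC.
have := @ln_sublinear R (a * y * ln 2).
by rewrite mulr_gt0 ?mulr_gt0// => /(_ isT)/ltW.
Qed.

(** * LZ78 code lengths and the universal distribution *)

Lemma size_lz78_parse_from (T : eqType) (dict : seq (seq T)) (cur s : seq T) :
  (size (lz78_parse_from dict cur s) <= size s + ~~ nilp cur)%N.
Proof.
elim: s dict cur => [|a s IHs] dict cur /=; first by case: (nilp cur).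
case: ifP => _; last first.
  by rewrite /= addSn ltnS (leq_trans (IHs _ _))// addn0 leq_addr.
rewrite (leq_trans (IHs _ _))// addSn -addnS leq_add2l.
by rewrite (leq_trans (leq_b1 _)).
Qed.

Lemma LZ_le (T : finType) (n : nat) (y : n.-tuple T) :
  (LZ y <= n * (up_log 2 n + #|T|))%N.
Proof.
have le_sz : (size (lz78_parse y) <= n)%N.
  by have := size_lz78_parse_from _ [::] [::] y; rewrite size_tuple addn0.
apply: (@leq_trans (\sum_(1 <= j < (size (lz78_parse y)).+1)
    (up_log 2 n + #|T|))).
  rewrite /LZ big_nat_cond [leqRHS]big_nat_cond.
  apply: leq_sum => j /andP[/andP[_ lt_j] _].
  apply: up_log_min => //; rewrite expnD leq_mul//.
    by rewrite (leq_trans _ (up_logP n _))// (leq_trans _ le_sz).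
  by rewrite ltnW// ltn_expl.
by rewrite sum_nat_const_nat subn1 leq_mul2r le_sz orbT.
Qed.

Section UniversalDistribution.
Variables (R : realType) (T : finType) (n : nat).

Lemma sum_LZ_ge0 : 0 <= \sum_(y : n.-tuple T) 2 ^- LZ y :> R.
Proof. by apply: sumr_ge0 => y _; rewrite invr_ge0 exprn_ge0. Qed.

Lemma univ_dist_ge0 (y : n.-tuple T) : 0 <= univ_dist R y.
Proof. by rewrite divr_ge0 ?sum_LZ_ge0// invr_ge0 exprn_ge0. Qed.

Lemma sum_univ_dist_le1 : \sum_(y : n.-tuple T) univ_dist R y <= 1.
Proof.
rewrite -mulr_suml; set Z := \sum_y _.
(* [Z] vanishes only when there are no words at all; hence an inequality and not an equality. *)
by have [->|Z_neq0] := eqVneq Z 0; rewrite ?mul0r// divff.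
Qed.

(** One [#|T|] comes from [LZ_le], the other from the normalizer, which is at most the number of
    words, [#|T| ^ n <= 2 ^ (n * #|T|)]. This caps the levels that a code has to write. *)
Lemma univ_dist_ge (y : n.-tuple T) :
  2 ^- (n * (up_log 2 n + #|T| + #|T|)) <= univ_dist R y.
Proof.
have LZ_le1 (y' : n.-tuple T) : 2 ^- LZ y' <= 1 :> R.
  by rewrite invf_le1 ?exprn_gt0// exprn_ege1// ler1n.
have Z_gt0 : 0 < \sum_(y' : n.-tuple T) 2 ^- LZ y' :> R.
  rewrite (bigD1 y)//=; apply: ltr_pwDl; first by rewrite invr_gt0 exprn_gt0.
  by apply: sumr_ge0 => y' _; rewrite invr_ge0 exprn_ge0.
rewrite mulnDr exprD invfM; apply: ler_pM.
- by rewrite invr_ge0 exprn_ge0.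
- by rewrite invr_ge0 exprn_ge0.
- by rewrite lef_pV2 ?posrE ?exprn_gt0// ler_eXn2l ?LZ_le// ltr1n.
- rewrite lef_pV2 ?posrE ?exprn_gt0//.
  apply: (@le_trans _ _ (\sum_(y' : n.-tuple T) 1)); first exact: ler_sum.
  rewrite sumr_const card_tuple -natrX ler_nat mulnC expnM.
  have [n0|n_gt0] := posnP n; first by rewrite n0.
  by rewrite leq_exp2r// ltnW// ltn_expl.
Qed.

End UniversalDistribution.

(** * Fixed-length binary words and codes built from an encoder *)

Definition bits (l i : nat) : seq bool :=
  nth (nseq l false) [seq val b | b : l.-tuple bool] i.

Lemma size_bits (l i : nat) : size (bits l i) = l.
Proof.
rewrite /bits.
have [lt_i|ge_i] := ltnP i (size [seq val b | b : l.-tuple bool]).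
  by have /mapP[b _ ->] := mem_nth (nseq l false) lt_i; rewrite size_tuple.
by rewrite nth_default// size_nseq.
Qed.

Lemma bits_inj (l i j : nat) : (i < 2 ^ l)%N -> (j < 2 ^ l)%N ->
  bits l i = bits l j -> i = j.
Proof.
have sz : size [seq val b | b : l.-tuple bool] = (2 ^ l)%N.
  by rewrite size_image card_tuple card_bool.
move=> lt_i lt_j /eqP; rewrite nth_uniq ?sz// => [/eqP//|].
by rewrite map_inj_uniq ?enum_uniq//; exact: val_inj.
Qed.

(** The strings are the range of [enc]. The decoder picks any preimage, harmlessly since [rep]
    factors through [enc]. *)
Lemma rd_code_of (X Y : finType) (n : nat)
    (enc : n.-tuple X -> seq bool) (rep : n.-tuple X -> n.-tuple Y) :
  (forall x x', prefix (enc x) (enc x') -> enc x = enc x') ->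
  (forall x x', enc x = enc x' -> rep x = rep x') ->
  exists C : rd_code X Y n,
    [/\ prefix_free C, forall x, reproduction C x = rep x &
        forall x, code_length C x = size (enc x)].
Proof.
move=> enc_prefix enc_rep.
pose B : {pred seq bool} := [pred b | [exists x, enc x == b]].
have encB x : enc x \in B by apply/existsP; exists x.
have decB (b : {b | b \in B}) : exists x, enc x == sval b.
  by apply/existsP; exact: (svalP b).
have inT (y : n.-tuple Y) : y \in [set: n.-tuple Y]%SET by rewrite inE.
pose C := @RDCode X Y n B [set: n.-tuple Y]%SET
  (fun x => exist _ (enc x) (encB x))
  (fun b => exist _ (rep (xchoose (decB b))) (inT _)).
exists C; split=> [b1 b2 /existsP[x /eqP<-] /existsP[x' /eqP<-]|x|//].
  by case=> /enc_prefix.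
by apply: enc_rep; apply/eqP; exact: (xchooseP (decB _)).
Qed.

(** * Greedy covering and the two-field code *)

Section GreedyCovering.
Variables (R : realType) (I T : finType) (P : T -> R) (S : I -> {set T}).
Hypotheses (P_ge0 : forall y, 0 <= P y) (sumP_le1 : \sum_y P y <= 1).

(* Some [y] lies in at least the [P]-average number of the sets [S i]. *)
Lemma greedy_step (q : R) (A : {set I}) : A != finset.set0 ->
  0 < q -> (forall i, i \in A -> q <= \sum_(y in S i) P y) ->
  exists y, q * #|A|%:R <= #|[set i in A | y \in S i]%SET|%:R.
Proof.
move=> /set0Pn[i0 Ai0] q_gt0 massA.
have [y0 _] : exists y, y \in S i0.
  apply/set0Pn/eqP => S0; have := massA _ Ai0.
  by rewrite S0 big_set0 leNgt q_gt0.
pose cnt y := #|[set i in A | y \in S i]%SET|.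
case: (@arg_maxnP _ y0 xpredT cnt isT) => y _ y_max.
(* Double counting: the masses of the [S i] over [A] sum to the [P]-weighted sum of [cnt], which is
   at most the maximum of [cnt]. *)
exists y; apply: (@le_trans _ _ (\sum_y' P y' * (cnt y')%:R)).
  rewrite mulr_natr -sumr_const.
  apply: (le_trans (ler_sum _ massA)).
  under eq_bigr do rewrite big_mkcond.
  rewrite exchange_big ler_sum// => y' _.
  rewrite -big_mkcondr sumr_const mulr_natr.
  by rewrite ler_wpMn2l//; apply/eq_leq/eq_card => i; rewrite inE.
apply: (@le_trans _ _ (\sum_y' P y' * (cnt y)%:R)).
  by apply: ler_sum => y' _; rewrite ler_wpM2l// ler_nat; exact: y_max.
by rewrite -mulr_suml ler_piMl.
Qed.

(** The mass bound passes to the subset still missed, so each new word removes at least a fraction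
    [q] of it. *)
Lemma greedy_uncovered (q : R) (A : {set I}) (m : nat) : 0 < q <= 1 ->
  (forall i, i \in A -> q <= \sum_(y in S i) P y) ->
  exists s : seq T, (size s <= m)%N /\
    #|[set i in A | ~~ has (mem (S i)) s]%SET|%:R <= #|A|%:R * (1 - q) ^+ m.
Proof.
move=> /andP[q_gt0 q_le1] massA; elim: m => [|m [s [sz_s le_s]]].
  exists [::]; split=> //; rewrite expr0 mulr1 ler_nat subset_leq_card//.
  by apply/fintype.subsetP => i; rewrite inE => /andP[].
set B := [set i in A | _]%SET in le_s.
have [B0|B_neq0] := eqVneq B finset.set0.
  exists s; split; first exact: leqW.
  by rewrite -/B B0 cards0 mulr_ge0// exprn_ge0// subr_ge0.
have [|y le_y] := @greedy_step q B B_neq0 q_gt0.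
  by move=> i; rewrite inE => /andP[/massA].
exists (y :: s); split=> //.
have -> : [set i in A | ~~ has (mem (S i)) (y :: s)]%SET =
    B :\: [set i in B | y \in S i]%SET.
  apply/setP => i; rewrite !inE /= negb_or.
  by case: (i \in A); case: (y \in S i); case: (has _ s).
rewrite cardsD (finset.setIidPr _); last first.
  by apply/fintype.subsetP => i; rewrite inE => /andP[].
rewrite natrB; last first.
  rewrite subset_leq_card//; apply/fintype.subsetP => i.
  by rewrite inE => /andP[].
apply: (@le_trans _ _ (#|B|%:R * (1 - q))).
  by rewrite mulrBr mulr1 mulrC lerD2l lerN2.
by rewrite exprSr mulrA ler_wpM2r// subr_ge0.
Qed.

(** Since 1 - q <= e^(-q), the power is at most 1/e, and e >= 1 + 1. *)
Lemma half_ge_expn (k : nat) : (1 - 2 ^- k) ^+ (2 ^ k) <= 2^-1 :> R.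
Proof.
have q_le1 : 2 ^- k <= 1 :> R.
  by rewrite invf_le1 ?exprn_gt0// exprn_ege1// ler1n.
apply: (@le_trans _ _ (expR (- 2 ^- k) ^+ (2 ^ k))).
  by rewrite lerXn2r ?nnegrE ?subr_ge0 ?expR_ge0// expR_ge1Dx.
rewrite -expRM_natl mulrN natrX divff ?expf_neq0// expRN.
rewrite lef_pV2 ?posrE ?expR_gt0//.
by have := @expR_ge1Dx R 1; rewrite -natr1.
Qed.

(** The [2 ^ (k + t)] choices form [2 ^ t] rounds of [2 ^ k], each at least halving the bound on the
    number of missed sets. That bound ends below 1, so none is missed. *)
Lemma covering (t k : nat) : (#|I| < 2 ^ (2 ^ t))%N ->
  exists s : seq T, (size s <= 2 ^ (k + t))%N /\
    forall i, 2 ^- k <= \sum_(y in S i) P y -> has (mem (S i)) s.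
Proof.
move=> ltI; pose A := [set i | 2 ^- k <= \sum_(y in S i) P y]%SET.
have [|i|s [sz_s le_s]] := @greedy_uncovered (2 ^- k) A (2 ^ (k + t)).
- by rewrite invr_gt0 exprn_gt0// invf_le1 ?exprn_gt0// exprn_ege1// ler1n.
- by rewrite inE.
exists s; split=> // i mass_i; apply: contraT => uncov.
have : (1 : R) <= #|A|%:R * (1 - 2 ^- k) ^+ (2 ^ (k + t)).
  apply: le_trans le_s; rewrite ler1n card_gt0; apply/set0Pn; exists i.
  by rewrite !inE mass_i.
rewrite leNgt => /negP[].
rewrite expnD exprM.
apply: (@le_lt_trans _ _ (#|I|%:R * 2^-1 ^+ (2 ^ t))).
  have q_ge0 : 0 <= (1 - 2 ^- k) ^+ (2 ^ k) :> R.
    by rewrite exprn_ge0// subr_ge0 invf_le1 ?exprn_gt0// exprn_ege1// ler1n.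
  apply: ler_pM => //; first by rewrite exprn_ge0.
    by rewrite ler_nat max_card.
  by rewrite lerXn2r ?nnegrE ?half_ge_expn.
by rewrite exprVn ltr_pdivrMr ?exprn_gt0// mul1r -natrX ltr_nat.
Qed.

(** [K] bounds every level, so [l] bits write it. The level field fixes the length of the index
    field, which makes the code prefix-free. *)
Lemma covering_code (K l t : nat) : (K < 2 ^ l)%N -> (#|I| < 2 ^ (2 ^ t))%N ->
  (forall i, 2 ^- K <= \sum_(y in S i) P y) ->
  exists (enc : I -> seq bool) (rep : I -> T),
    [/\ forall i, rep i \in S i,
        forall i j, prefix (enc i) (enc j) -> enc i = enc j,
        forall i j, enc i = enc j -> rep i = rep j &
        forall i, (size (enc i))%:R <=
          - log2 (\sum_(y in S i) P y) + 1 + l%:R + t%:R].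
Proof.
move=> ltK ltI mass_ge.
have [book bookP] := choice (fun k => covering t k ltI).
have ex_k i : exists k, 2 ^- k <= \sum_(y in S i) P y by exists K.
pose k i := ex_minn (ex_k i).
have kP i : 2 ^- (k i) <= \sum_(y in S i) P y by rewrite /k; case: ex_minnP.
have k_lt i : (k i < 2 ^ l)%N.
  by apply: leq_ltn_trans ltK; rewrite /k; case: ex_minnP => m _; apply.
pose ix i := find (mem (S i)) (book (k i)).
have hasS i : has (mem (S i)) (book (k i)) by have [_] := bookP (k i); apply.
have ix_lt i : (ix i < 2 ^ (k i + t))%N.
  by have [sz _] := bookP (k i); apply: leq_trans sz; rewrite -has_find.
(* Quantifying over the default [y'] lets [rep] depend on level and index only. *)
have ex_rep i :
    exists y, y \in S i /\ forall y', nth y' (book (k i)) (ix i) = y.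
  have [y _ _] := hasP (hasS i); exists (nth y (book (k i)) (ix i)).
  split=> [|y']; first exact: (nth_find y (hasS i)).
  by apply: set_nth_default; rewrite -has_find.
have [rep repP] := choice ex_rep.
pose enc i := bits l (k i) ++ bits (k i + t) (ix i).
have enc_k i j s : enc i ++ s = enc j -> k i = k j.
  move=> /(congr1 (take l)); rewrite /enc -catA !take_size_cat ?size_bits//.
  exact: bits_inj.
exists enc, rep; split=> [i|i j|i j eq_enc|i].
- by have [] := repP i.
- move=> /prefixP[s e]; have eqk := enc_k _ _ _ (esym e).
  have s0 : s = [::].
    apply/nilP; move: (congr1 size e).
    rewrite !size_cat !size_bits eqk.
    by rewrite -[LHS]addn0 => /addnI/esym/eqP.
  by rewrite e s0 cats0.
- have eqk : k i = k j by apply: (enc_k _ _ [::]); rewrite cats0.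
  have eqix : ix i = ix j.
    move/eqP: eq_enc; rewrite /enc eqk eqseq_cat ?size_bits// => /andP[_ /eqP].
    by apply: bits_inj => //; rewrite -eqk.
  have [_ repi] := repP i; have [_ repj] := repP j.
  by rewrite -(repi (rep i)) -(repj (rep i)) eqk eqix.
- rewrite size_cat !size_bits !natrD.
  set p := \sum_(y in S i) P y.
  have p_gt0 : 0 < p by apply: lt_le_trans (kP i); rewrite invr_gt0 exprn_gt0.
  suff : (k i)%:R <= - log2 p + 1 by lra.
  (* Rounding up costs at most one bit: level 0 uses total mass at most 1, and level [m.+1] is
     minimal only if the mass is below [2 ^- m]. *)
  rewrite /k; case: ex_minnP => -[|m] _ m_min.
    have p_le1 : p <= 1.
      apply: le_trans sumP_le1; rewrite [leRHS](bigID (mem (S i)))/=.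
      by rewrite lerDl sumr_ge0.
    have := @ler_log2 R _ _ p_gt0 p_le1.
    rewrite -(expr0 2) log2_expn; lra.
  have p_lt : p <= 2 ^- m.
    by rewrite leNgt; apply/negP => /ltW/m_min; rewrite ltnn.
  have := @ler_log2 R _ _ p_gt0 p_lt.
  rewrite log2_expnN -natr1; lra.
Qed.

End GreedyCovering.

(** * Choice of parameters and the final length bound *)

Lemma block_code (R : realType) (X Y : finType) (n : nat) (D : R)
    (d : n.-tuple X -> n.-tuple Y -> R) : (0 < n)%N ->
  (forall x, exists y, y \in sphere d D x) ->
  exists C : rd_code X Y n, [/\ prefix_free C, semifaithful C d D &
    forall x, (code_length C x)%:R <=
      - log2 (univ_mass R (sphere d D x)) + 1
      + (up_log 2 n + up_log 2 (up_log 2 n + #|Y| + #|Y|).+1)%:R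
      + (up_log 2 n + #|X|)%:R].
Proof.
move=> n_gt0 feasible.
have le_n : (n <= 2 ^ up_log 2 n)%N by exact: up_logP.
(* The top level is the exponent in [univ_dist_ge]; the [.+1] makes it strictly less than [2 ^ l].
   The last parameter [t] gives [#|X| ^ n < 2 ^ (n * #|X|) <= 2 ^ (2 ^ t)]. *)
have [||x|enc [rep [repS enc_prefix enc_rep enc_size]]] :=
    @covering_code R _ _ (@univ_dist R Y n) (sphere d D)
      (@univ_dist_ge0 R Y n) (sum_univ_dist_le1 R Y n)
      (n * (up_log 2 n + #|Y| + #|Y|))
      (up_log 2 n + up_log 2 (up_log 2 n + #|Y| + #|Y|).+1) (up_log 2 n + #|X|).
- rewrite expnD; apply: (@leq_trans (n * (up_log 2 n + #|Y| + #|Y|).+1)).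
    by rewrite ltn_pmul2l.
  by rewrite leq_mul// up_logP.
- rewrite card_tuple; apply: (@leq_trans ((2 ^ #|X|) ^ n)).
    by rewrite ltn_exp2r// ltn_expl.
  rewrite -expnM leq_exp2l// mulnC expnD leq_mul//.
  by rewrite ltnW// ltn_expl.
- have [y yS] := feasible x; apply: (le_trans (univ_dist_ge R Y n y)).
  by rewrite (bigD1 y)//= lerDl sumr_ge0// => y' _; exact: univ_dist_ge0.
have [C [Cpf Crep Clen]] := @rd_code_of X Y n enc rep enc_prefix enc_rep.
exists C; split=> // x; first by have := repS x; rewrite inE Crep.
by rewrite Clen.
Qed.

Theorem theorem2 (R : realType) (X Xhat : finType) (D : R)
    (d : forall n : nat, n.-tuple X -> n.-tuple Xhat -> R)
    (d_ge0 : forall (n : nat) (x : n.-tuple X) (y : n.-tuple Xhat),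
      (0 < n)%N -> 0 <= d n x y)
    (feasible : forall (n : nat) (x : n.-tuple X),
      (0 < n)%N -> exists y : n.-tuple Xhat, y \in sphere (d n) D x)
    (eps : R) (eps_gt0 : 0 < eps) :
  exists (C : forall n : nat, rd_code X Xhat n) (c : R) (delta : nat -> R),
    0 < c /\
    delta =O_\oo (fun n : nat =>
      n%:R * #|X|%:R ^+ n * expR (- (n%:R `^ (1 + eps)))) /\
    forall n : nat, (0 < n)%N ->
      prefix_free (C n) /\
      semifaithful (C n) (d n) D /\
      forall x : n.-tuple X,
        (code_length (C n) x)%:R <=
          - log2 (univ_mass R (sphere (d n) D x))
          + (2 + eps) * log2 n%:R + c + delta n.
Proof.
have [b log2_le] := @log2_le_linear R eps eps_gt0.
pose J : R := #|X|%:R; pose K : R := #|Xhat|%:R.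
have ex_C n : exists C : rd_code X Xhat n, (0 < n)%N ->
    [/\ prefix_free C, semifaithful C (d n) D &
    forall x, (code_length C x)%:R <=
      - log2 (univ_mass R (sphere (d n) D x)) + 1
      + (up_log 2 n + up_log 2 (up_log 2 n + #|Xhat| + #|Xhat|).+1)%:R
      + (up_log 2 n + #|X|)%:R].
  (* Length 0 is filled with the empty codeword and the empty tuple to make the family total. *)
  case: n => [|n].
    have [//|//|C _] := @rd_code_of X Xhat 0 (fun=> [::]) (fun=> [tuple]).
    by exists C.
  have [|C CP] := @block_code R X Xhat n.+1 D (d n.+1) isT.
    by move=> x; exact: feasible.
  by exists C.
pose C n := sval (cid (ex_C n)); have CP n := svalP (cid (ex_C n)).
(* The 4 is the rounding of the level plus three ceilings: [up_log 2 n] twice and [up_log 2 v.+1].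
   The [eps] term is what [eps * v.+1] leaves beyond [eps * log2 n]; the absolute value keeps the
   constant positive. *)
exists C, (J + 4 + eps * (2 + K + K) + `|b|), (fun=> 0); split; last split.
- have : 0 <= eps * (2 + K + K).
    by rewrite mulr_ge0 ?(ltW eps_gt0)// !addr_ge0// ler0n.
  have : 0 <= J by rewrite ler0n.
  have := normr_ge0 b; lra.
- apply/eqO_exP; exists 1 => //; near=> n.
  by rewrite normr0 mul1r.
move=> n n_gt0; have [Cpf Csf Clen] := CP n n_gt0.
do 2!split=> //; move=> x; apply: le_trans (Clen x) _.
set u := up_log 2 n; set v := (u + _ + _)%N.
have u_le : u%:R <= log2 (n%:R : R) + 1 by exact: up_log_le_log2.
have v_le : (up_log 2 v.+1)%:R <= eps * v.+1%:R + b + 1 :> R.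
  by apply: (le_trans (@up_log_le_log2 R v.+1 isT)); rewrite lerD2r log2_le.
have ev_le : eps * v.+1%:R <= eps * (log2 n%:R + 1 + K + K + 1).
  by rewrite ler_wpM2l ?(ltW eps_gt0)// /v -natr1 !natrD -/K; lra.
rewrite !natrD -/J.
have := ler_norm b.
lra.
Unshelve. all: by end_near.
Qed.
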